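(* Let $p,q,r$ be real functions on $[a,b]$ with $p,r>0$, smooth enough that all derivatives below exist. Let $\delta_0,\delta_1$ be real and not both zero, and let $\gamma_0,\gamma_1$ be real and not both zero. Let Liouville's transformation be given by $$t=\int\sqrt{\frac{r}{p}}\,dx,\qquad w=(pr)^{-1/4},\qquad u(x)=w(x)\,v(x),$$ mapping $a<x<b$ to $\alpha<t<\beta$, and put $$I(t)=\frac{q}{r}+w\frac{d^2}{dt^2}\left(\frac1w\right),\qquad P(t)=\frac{p\,w^2}{\dot x},\qquad \dot x=\frac{dx}{dt},$$ $$\delta_2=\left.\left(\delta_0w^2-\delta_1\,p\,w\frac{dw}{dx}\right)\right|_{x=a},\qquad \gamma_2=\left.\left(\gamma_0w^2-\gamma_1\,p\,w\frac{dw}{dx}\right)\right|_{x=b}.$$ Then the Sturm-Liouville problem in Schrödinger form $$-\frac{d^2v}{dt^2}+I(t)\,v=\lambda v,\quad \alpha<t<\beta,$$ $$\delta_2v(\alpha)-\delta_1P(\alpha)\frac{dv}{dt}(\alpha)=0,\qquad \gamma_2v(\beta)-\gamma_1P(\beta)\frac{dv}{dt}(\beta)=0,$$ is inverted by this same Liouville transformation (that is, via $v=u/w$ and $t=t(x)$) back to the eigenvalue problem in canonical form $$-\frac{d}{dx}\left[p(x)\frac{du}{dx}\right]+q(x)\,u=\lambda\, r(x)\,u,\quad a<x<b,$$ $$\delta_0u(a)-\delta_1p(a)\frac{du}{dx}(a)=0,\qquad \gamma_0u(b)-\gamma_1p(b)\frac{du}{dx}(b)=0,$$ with the same eigenvalue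 parameter $\lambda$.
   Context: Functions of $x$ and of $t$ are identified through the change of variable: for example, $w$ regarded as a function of $t$ is $w(x(t))$. *)

(* Defs.v *)
From Stdlib Require Import Reals ClassicalEpsilon.
From Coquelicot Require Import Coquelicot.
Local Open Scope R_scope.

Definition cc (a b x : R) : Prop := a <= x <= b.

(* Derivatives are taken relative to the domain [D] of the function (the
   standard library's [D_in]), so that on a closed interval they are the usual
   derivatives at interior points and the one-sided ones at the endpoints, and
   values of the function outside [D] are irrelevant. *)
Definition ex_deriv (D : R -> Prop) (f : R -> R) (x : R) : Prop :=
  exists l, D_in f (fun _ => l) D x.

(* Arbitrary value where the derivative does not exist. *)
Definition Deriv (D : R -> Prop) (f : R -> R) (x : R) : R :=
  epsilon (inhabits 0) (fun l => D_in f (fun _ => l) D x).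

(* The integral defining t is indefinite; the free constant is the value
   [alpha] of t at [a]. *)
Definition liouville_t (p r : R -> R) (a alpha x : R) : R :=
  alpha + RInt (fun y => sqrt (r y / p y)) a x.

Definition liouville_w (p r : R -> R) (x : R) : R :=
  Rpower (p x * r x) (- (1 / 4)).

(* The inverse change of variable t |-> x(t), from [alpha, t(b)] to [a, b]. *)
Definition liouville_x (p r : R -> R) (a b alpha s : R) : R :=
  epsilon (inhabits a) (fun x => cc a b x /\ liouville_t p r a alpha x = s).

(* d/dt (1/w), with 1/w regarded as a function of t. *)
Definition liouville_dinvw (p r : R -> R) (a b alpha s : R) : R :=
  Deriv (cc alpha (liouville_t p r a alpha b))
    (fun z => / liouville_w p r (liouville_x p r a b alpha z)) s.

Definition liouville_I (p q r : R -> R) (a b alpha s : R) : R :=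
  let x := liouville_x p r a b alpha s in
  q x / r x
  + liouville_w p r x
    * Deriv (cc alpha (liouville_t p r a alpha b))
        (liouville_dinvw p r a b alpha) s.

Definition liouville_P (p r : R -> R) (a b alpha s : R) : R :=
  let x := liouville_x p r a b alpha s in
  let xdot := Deriv (cc alpha (liouville_t p r a alpha b))
                (liouville_x p r a b alpha) s in
  p x * liouville_w p r x ^ 2 / xdot.

(* [c0 w^2 - c1 p w dw/dx] at the endpoint [e] of [a, b]. *)
Definition liouville_bc (p r : R -> R) (a b c0 c1 e : R) : R :=
  let w := liouville_w p r in
  c0 * w e ^ 2 - c1 * p e * w e * Deriv (cc a b) w e.

(* [u] is a (possibly zero) classical solution: differentiable on [a, b],
   with [p u'] differentiable on (a, b). *)
Definition canonical_problem (p q r : R -> R) (a b d0 d1 g0 g1 lam : R)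
    (u : R -> R) : Prop :=
  let du := Deriv (cc a b) u in
  let pdu := fun x => p x * du x in
  (forall x, a <= x <= b -> ex_deriv (cc a b) u x) /\
  (forall x, a < x < b ->
     ex_deriv (cc a b) pdu x /\
     - Deriv (cc a b) pdu x + q x * u x = lam * r x * u x) /\
  d0 * u a - d1 * p a * du a = 0 /\
  g0 * u b - g1 * p b * du b = 0.

(* [v] is a (possibly zero) classical solution: differentiable on
   [alpha, beta], with [v'] differentiable on (alpha, beta). *)
Definition schrodinger_problem (I P : R -> R) (alpha beta d2 d1 g2 g1 lam : R)
    (v : R -> R) : Prop :=
  let dv := Deriv (cc alpha beta) v in
  (forall s, alpha <= s <= beta -> ex_deriv (cc alpha beta) v s) /\
  (forall s, alpha < s < beta ->
     ex_deriv (cc alpha beta) dv s /\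
     - Deriv (cc alpha beta) dv s + I s * v s = lam * v s) /\
  d2 * v alpha - d1 * P alpha * dv alpha = 0 /\
  g2 * v beta - g1 * P beta * dv beta = 0.

Definition eigenvalue_on (a b : R) (problem : R -> (R -> R) -> Prop)
    (lam : R) : Prop :=
  exists u, problem lam u /\ exists x, a <= x <= b /\ u x <> 0.

(* Main.v *)
(* With tau = dt/dx = sqrt(r/p) one has p tau w^2 = 1 and tau = r w^2.  Put
   m = 1/w.  Then dm/dt = - p dw/dx, so the flux of u = w v is
   p du/dx = m dv/dt - v dm/dt.  The first-order cross terms cancel when it is
   differentiated, so that d/dx (p du/dx) = r w (d^2v/dt^2 - v w d^2m/dt^2),
   and the two equations differ by the nonzero factor r w.  The boundary
   conditions likewise differ by the factor w, as P = 1. *)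

Require Import Defs.
From Stdlib Require Import Reals Lra ClassicalEpsilon.
From Coquelicot Require Import Coquelicot.
Local Open Scope R_scope.

(** * Calculus of derivatives relative to a domain *)

Definition has_deriv (D : R -> Prop) (f : R -> R) (x l : R) : Prop :=
  D_in f (fun _ => l) D x.

Lemma has_deriv_Deriv (D : R -> Prop) (f : R -> R) (x : R) :
  ex_deriv D f x -> has_deriv D f x (Deriv D f x).
Proof. exact (epsilon_spec (inhabits 0) (fun l => has_deriv D f x l)). Qed.

(** Limits within a domain are unique only at its accumulation points; elsewhere every number would
    be a derivative. From [x] one moves towards [b] if there is room, otherwise towards [a]. *)
Lemma adhDa_cc (a b x : R) : a < b -> cc a b x -> adhDa (D_x (cc a b) x) x.
Proof.
intros hab hx eps he; unfold D_x, cc in *.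
destruct (Rlt_dec x b) as [hxb | hxb].
- set (h := Rmin (b - x) (eps / 2)).
  assert (h <= b - x) by apply Rmin_l.
  assert (h <= eps / 2) by apply Rmin_r.
  assert (0 < h) by (apply Rmin_pos; lra).
  exists (x + h); repeat split; try lra.
  unfold Rdist; rewrite Rabs_pos_eq; lra.
- set (h := Rmin (x - a) (eps / 2)).
  assert (h <= x - a) by apply Rmin_l.
  assert (h <= eps / 2) by apply Rmin_r.
  assert (0 < h) by (apply Rmin_pos; lra).
  exists (x - h); repeat split; try lra.
  unfold Rdist; rewrite Rabs_left; lra.
Qed.

Lemma has_deriv_unique (a b : R) (f : R -> R) (x l l' : R) :
  a < b -> cc a b x ->
  has_deriv (cc a b) f x l -> has_deriv (cc a b) f x l' -> l = l'.
Proof.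
intros hab hx; unfold has_deriv, D_in.
exact (single_limit _ _ l l' x (adhDa_cc a b x hab hx)).
Qed.

Lemma Deriv_eq (a b : R) (f : R -> R) (x l : R) :
  a < b -> cc a b x -> has_deriv (cc a b) f x l -> Deriv (cc a b) f x = l.
Proof.
intros hab hx hl; apply (has_deriv_unique a b f x); auto.
apply has_deriv_Deriv; exists l; exact hl.
Qed.

Lemma has_deriv_ext (D : R -> Prop) (f g : R -> R) (x l : R) :
  D x -> (forall y, D y -> f y = g y) -> has_deriv D f x l -> has_deriv D g x l.
Proof.
intros hx hfg hf eps he; destruct (hf eps he) as [del [hdel h]].
exists del; split; auto; intros y [[hy hyx] hd].
rewrite <- (hfg y hy), <- (hfg x hx); apply h; repeat split; auto.
Qed.

Lemma has_deriv_mult (D : R -> Prop) (f g : R -> R) (x l m : R) :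
  has_deriv D f x l -> has_deriv D g x m ->
  has_deriv D (fun y => f y * g y) x (l * g x + f x * m).
Proof. exact (Dmult D (fun _ => l) (fun _ => m) f g x). Qed.

Lemma has_deriv_plus (D : R -> Prop) (f g : R -> R) (x l m : R) :
  has_deriv D f x l -> has_deriv D g x m ->
  has_deriv D (fun y => f y + g y) x (l + m).
Proof. exact (Dadd D (fun _ => l) (fun _ => m) f g x). Qed.

Lemma has_deriv_minus (D : R -> Prop) (f g : R -> R) (x l m : R) :
  has_deriv D f x l -> has_deriv D g x m ->
  has_deriv D (fun y => f y - g y) x (l - m).
Proof. exact (Dminus D (fun _ => l) (fun _ => m) f g x). Qed.

Lemma has_deriv_comp (D E : R -> Prop) (f g : R -> R) (x l m : R) :
  (forall y, D y -> E (f y)) ->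
  has_deriv D f x l -> has_deriv E g (f x) m ->
  has_deriv D (fun y => g (f y)) x (l * m).
Proof.
intros hDE hf hg eps he.
(* [Dcomp] yields a derivative relative to the points of [D] that [f] sends into [E]; by [hDE] these
   are all of [D]. *)
destruct (Dcomp D E (fun _ => l) (fun _ => m) f g x hf hg eps he)
  as [del [hdel h]].
exists del; split; auto; intros y [[hy hyx] hd].
apply h; repeat split; auto.
Qed.

Lemma has_deriv_of_derivable_pt_lim (D : R -> Prop) (f : R -> R) (x l : R) :
  derivable_pt_lim f x l -> has_deriv D f x l.
Proof.
intros hf.
assert (hn := proj2 (derivable_pt_lim_D_in f (fun _ => l) x) hf).
intros eps he; destruct (hn eps he) as [del [hdel h]].
exists del; split; auto; intros y [[hy hyx] hd].
apply h; repeat split; auto.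
Qed.

Lemma has_deriv_inv (D : R -> Prop) (f : R -> R) (x l : R) :
  f x <> 0 -> has_deriv D f x l ->
  has_deriv D (fun y => / f y) x (- l / f x ^ 2).
Proof.
intros hfx hf.
assert (hi : derivable_pt_lim Rinv (f x) (- / f x ^ 2)).
{ apply is_derive_Reals; auto_derive; auto; field; auto. }
replace (- l / f x ^ 2) with (l * - / f x ^ 2) by (field; auto).
apply (has_deriv_comp D (fun _ => True)); auto.
apply has_deriv_of_derivable_pt_lim; exact hi.
Qed.

(** * The change of variable and its inverse *)

Definition clamp (a b x : R) : R := Rmax a (Rmin b x).

Lemma clamp_cc (a b x : R) : a < b -> cc a b (clamp a b x).
Proof.
intros hab; split; [apply Rmax_l | apply Rmax_lub; [lra | apply Rmin_l]].
Qed.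

Lemma clamp_id (a b x : R) : cc a b x -> clamp a b x = x.
Proof.
intros [h1 h2]; unfold clamp; rewrite Rmin_right, Rmax_right; lra.
Qed.

Lemma clamp_contracts (a b x y : R) :
  a < b -> Rabs (clamp a b x - clamp a b y) <= Rabs (x - y).
Proof.
intros hab; unfold clamp, Rmax, Rmin, Rabs.
repeat (destruct Rle_dec || destruct Rcase_abs); lra.
Qed.

(** Clamping does not increase distances and lands in [[a, b]], so one-sided continuity at the
    endpoints becomes continuity on all of R. The two-sided fundamental theorem of calculus can then
    be applied to the integral defining t. *)
Lemma continuous_clamp (a b : R) (f : R -> R) :
  a < b -> (forall x, a <= x <= b -> continue_in f (cc a b) x) ->
  continuity (fun x => f (clamp a b x)).
Proof.
intros hab hf x eps he.
destruct (hf (clamp a b x) (clamp_cc a b x hab) eps he) as [del [hdel h]].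
exists del; split; auto; intros y [_ hd]; simpl in *; unfold Rdist in *.
(* [continue_in] speaks of a punctured domain, so distinct points with the same clamped value are
   treated apart. *)
destruct (Req_dec (clamp a b y) (clamp a b x)) as [e | ne].
- rewrite e, Rminus_diag, Rabs_R0; exact he.
- apply h; repeat split; auto; try apply clamp_cc; auto.
  apply Rle_lt_trans with (2 := hd); apply clamp_contracts; auto.
Qed.

(** The interface between the construction of t and the transformation of the problems: an
    increasing bijection of closed intervals, with inverse [xt] and [tau] in the role of dt/dx. The
    closed and open versions serve the boundary conditions and the equations respectively. *)
Record reparam (a b alpha beta : R) (t xt tau : R -> R) : Prop := {
  reparam_lt : a < b;
  reparam_lt' : alpha < beta;
  reparam_a : t a = alpha;
  reparam_cc : forall x, cc a b x -> cc alpha beta (t x);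
  reparam_oo : forall x, a < x < b -> alpha < t x < beta;
  reparam_cc' : forall s, cc alpha beta s -> cc a b (xt s);
  reparam_oo' : forall s, alpha < s < beta -> a < xt s < b;
  reparam_left : forall x, cc a b x -> xt (t x) = x;
  reparam_right : forall s, cc alpha beta s -> t (xt s) = s;
  reparam_pos : forall x, cc a b x -> 0 < tau x;
  reparam_deriv : forall x, cc a b x -> has_deriv (cc a b) t x (tau x);
  reparam_deriv' : forall s, cc alpha beta s ->
    has_deriv (cc alpha beta) xt s (/ tau (xt s))
}.

(** The difference quotient of [xt] is the reciprocal of that of [t] between the corresponding
    points. The expansion bound makes [xt] Lipschitz with constant 1/c, so these points do
    converge. *)
Lemma has_deriv_inverse (a b alpha beta c : R) (t xt : R -> R) (s l : R) :
  (forall z, cc alpha beta z -> cc a b (xt z) /\ t (xt z) = z) ->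
  0 < c ->
  (forall y z, cc a b y -> cc a b z ->
     c * Rabs (y - z) <= Rabs (t y - t z)) ->
  cc alpha beta s -> l <> 0 ->
  has_deriv (cc a b) t (xt s) l -> has_deriv (cc alpha beta) xt s (/ l).
Proof.
intros hxt hc hexp hs hl ht eps he.
destruct (hxt s hs) as [hsc hst].
destruct (limit_inv _ _ _ _ ht hl eps he) as [del [hdel h]].
(* By expansion, moving s by less than [c * del] moves [xt s] by less than [del]. *)
exists (c * del); split; [now apply Rmult_gt_0_compat|].
intros z [[hz hzs] hd]; simpl in *; unfold Rdist in *.
destruct (hxt z hz) as [hzc hzt].
assert (hne : xt z <> xt s) by congruence.
assert (hdist : Rabs (xt z - xt s) < del).
{ apply Rmult_lt_reg_l with c; auto.
  apply Rle_lt_trans with (2 := hd).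
  rewrite <- hzt, <- hst at 2; auto. }
assert (hlim := h (xt z) (conj (conj hzc (not_eq_sym hne)) hdist)).
rewrite hzt, hst in hlim.
replace ((xt z - xt s) / (z - s)) with (/ ((z - s) / (xt z - xt s)));
  [exact hlim | field; lra].
Qed.

(** [T] is an extension of [t] differentiable on all of R, to which the mean and intermediate value
    theorems apply. The condition on [xt] is restricted to values attained by [t], as a choice of
    preimage is meaningful only there. *)
Lemma reparam_of_derivable (a b : R) (t T xt tau : R -> R) :
  a < b ->
  continuity tau -> (forall x, 0 < tau x) ->
  (forall x, derivable_pt_lim T x (tau x)) ->
  (forall x, cc a b x -> t x = T x) ->
  (forall s, (exists x, cc a b x /\ t x = s) ->
     cc a b (xt s) /\ t (xt s) = s) ->
  reparam a b (t a) (t b) t xt tau.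
Proof.
intros hab htau hpos hT htT hxt.
assert (haa : cc a b a) by (unfold cc; lra).
assert (hbb : cc a b b) by (unfold cc; lra).
assert (hcont : continuity T).
{ intros x; apply derivable_continuous_pt; exists (tau x); apply hT. }
(* The minimum of the positive function [tau] on the compact interval is the expansion constant
   [c]. *)
destruct (continuity_ab_min tau a b (Rlt_le _ _ hab)) as [mx [hmin _]].
{ intros; apply htau. }
set (c := tau mx) in *.
assert (hc : 0 < c) by apply hpos.
assert (hinc : forall x y, cc a b x -> cc a b y -> x < y ->
                 c * (y - x) <= t y - t x).
{ intros x y hx hy hxy; rewrite !htT; auto.
  destruct (MVT_cor2 T tau x y hxy) as [z [hz1 hz2]]; [intros; apply hT|].
  rewrite hz1; apply Rmult_le_compat_r; [lra|].
  unfold cc in *; apply hmin; lra. }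
assert (hlt : forall x y, cc a b x -> cc a b y -> x < y -> t x < t y).
{ intros x y hx hy hxy; assert (h := hinc x y hx hy hxy).
  assert (0 < c * (y - x)) by (apply Rmult_lt_0_compat; lra); lra. }
assert (hle : forall x y, cc a b x -> cc a b y -> x <= y -> t x <= t y).
{ intros x y hx hy [h | h]; [apply Rlt_le; auto | subst; lra]. }
assert (hexp : forall y z, cc a b y -> cc a b z ->
                 c * Rabs (y - z) <= Rabs (t y - t z)).
{ intros y z hy hz; destruct (Rtotal_order y z) as [h | [h | h]].
  - rewrite (Rabs_minus_sym y), (Rabs_minus_sym (t y)).
    assert (hl := hlt y z hy hz h); rewrite !Rabs_pos_eq by lra; auto.
  - subst; rewrite !Rminus_diag, Rabs_R0; lra.
  - assert (hl := hlt z y hz hy h); rewrite !Rabs_pos_eq by lra; auto. }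
assert (hinv : forall s, cc (t a) (t b) s -> cc a b (xt s) /\ t (xt s) = s).
{ intros s hs; apply hxt.
  (* Every value between [t a] and [t b] is attained, so the choice made by [xt] is a genuine
     preimage. *)
  destruct (IVT_gen T a b s hcont) as [x [hx1 hx2]].
  { rewrite <- !htT; auto.
    assert (hl := hlt a b haa hbb hab).
    rewrite Rmin_left, Rmax_right; auto; lra. }
  rewrite Rmin_left, Rmax_right in hx1 by lra.
  exists x; split; auto; rewrite htT; auto. }
assert (hcc : forall x, cc a b x -> cc (t a) (t b) (t x)).
{ intros x hx; split; apply hle; auto; apply hx. }
assert (hder : forall x, cc a b x -> has_deriv (cc a b) t x (tau x)).
{ intros x hx; apply has_deriv_ext with T; auto.
  - intros; symmetry; auto.
  - apply has_deriv_of_derivable_pt_lim; auto. }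
constructor; auto.
- intros x hx; assert (hx' : cc a b x) by (unfold cc; lra).
  split; apply hlt; auto; lra.
- intros s hs; apply hinv; exact hs.
- intros s hs; destruct (hinv s) as [[h1 h2] h3]; [unfold cc; lra|].
  split.
  (* An interior s cannot have an endpoint as preimage, since its value would be [t a] or [t b]. *)
  + destruct h1 as [h1 | h1]; auto; rewrite <- h1 in h3; lra.
  + destruct h2 as [h2 | h2]; auto; rewrite h2 in h3; lra.
- intros x hx; destruct (hinv (t x) (hcc x hx)) as [h1 h2].
  destruct (Rtotal_order (xt (t x)) x) as [h | [h | h]]; auto;
    apply hlt in h; auto; lra.
- intros s hs; apply hinv; exact hs.
- intros s hs; apply (has_deriv_inverse a b _ _ c t); auto.
  + apply Rgt_not_eq, hpos.
  + apply hder, hinv, hs.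
Qed.

Lemma reparam_ext (a b alpha beta : R) (t xt tau tau' : R -> R) :
  (forall x, cc a b x -> tau x = tau' x) ->
  reparam a b alpha beta t xt tau -> reparam a b alpha beta t xt tau'.
Proof.
intros he []; constructor; auto.
- intros x hx; rewrite <- he; auto.
- intros x hx; rewrite <- he; auto.
- intros s hs; rewrite <- he; auto.
Qed.

(** Integrating the clamped integrand gives the global primitive [T]. It agrees with [t] on
    [[a, b]], where clamping changes nothing. *)
Lemma liouville_reparam (p r : R -> R) (a b alpha : R) :
  a < b ->
  (forall x, a <= x <= b -> 0 < p x) ->
  (forall x, a <= x <= b -> 0 < r x) ->
  (forall x, a <= x <= b -> continue_in p (cc a b) x) ->
  (forall x, a <= x <= b -> continue_in r (cc a b) x) ->
  reparam a b alpha (liouville_t p r a alpha b) (liouville_t p r a alpha)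
    (liouville_x p r a b alpha) (fun x => sqrt (r x / p x)).
Proof.
intros hab hp hr hpc hrc.
set (t := liouville_t p r a alpha).
set (tau := fun x => sqrt (r (clamp a b x) / p (clamp a b x))).
assert (hta : t a = alpha).
{ unfold t, liouville_t; rewrite RInt_point; unfold zero; simpl; ring. }
assert (hdiv : forall x, 0 < r (clamp a b x) / p (clamp a b x)).
{ intros x; apply Rdiv_lt_0_compat; [apply hr | apply hp]; apply clamp_cc; auto. }
assert (htau : continuity tau).
{ intros x; apply (continuity_pt_comp
    (fun x => r (clamp a b x) / p (clamp a b x)) sqrt).
  - apply continuity_pt_div.
    + apply (continuous_clamp a b r hab hrc).
    + apply (continuous_clamp a b p hab hpc).
    + apply Rgt_not_eq, hp, clamp_cc, hab.
  - apply continuity_pt_sqrt; apply Rlt_le, hdiv. }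
assert (hctau : forall x, continuous tau x).
{ intros x; apply continuity_pt_filterlim, htau. }
rewrite <- hta at 1.
apply reparam_ext with tau.
{ intros x hx; unfold tau; rewrite clamp_id; auto. }
apply reparam_of_derivable with (T := fun x => alpha + RInt tau a x); auto.
- intros x; apply sqrt_lt_R0, hdiv.
- intros x; apply is_derive_Reals.
  replace (tau x) with (plus 0 (tau x)) by (unfold plus; simpl; ring).
  apply (is_derive_plus (fun _ => alpha) (fun x => RInt tau a x) x).
  + apply (is_derive_const alpha x).
  + apply is_derive_RInt with a; auto.
    apply filter_forall; intros y.
    apply (RInt_correct tau a y), (ex_RInt_continuous tau a y); auto.
- intros x hx; unfold t, liouville_t; f_equal.
  unfold cc in hx; apply RInt_ext; intros y hy.
  rewrite Rmin_left, Rmax_right in hy by lra.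
  unfold tau; rewrite clamp_id; auto; unfold cc; lra.
- intros s hs; unfold liouville_x; fold t.
  (* [epsilon] satisfies its predicate once some preimage exists, which is what [hs] provides. *)
  exact (epsilon_spec (inhabits a) (fun x => cc a b x /\ t x = s) hs).
Qed.

(** * Algebraic identities for the weight w *)

Lemma liouville_w_pos (p r : R -> R) (x : R) : 0 < liouville_w p r x.
(* [Rpower] is an exponential, hence positive whatever its base. *)
Proof. apply exp_pos. Qed.

Lemma liouville_w_sqr (p r : R -> R) (x : R) :
  0 < p x -> 0 < r x -> liouville_w p r x ^ 2 = / (sqrt (p x) * sqrt (r x)).
Proof.
intros hp hr; unfold liouville_w; simpl; rewrite Rmult_1_r, <- Rpower_plus.
replace (- (1 / 4) + - (1 / 4)) with (- / 2) by field.
rewrite Rpower_Ropp, Rpower_sqrt, sqrt_mult; auto; try lra.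
apply Rmult_lt_0_compat; auto.
Qed.

Lemma liouville_p_tau (p r : R -> R) (x : R) :
  0 < p x -> 0 < r x ->
  p x * sqrt (r x / p x) * liouville_w p r x ^ 2 = 1.
Proof.
intros hp hr; rewrite liouville_w_sqr, sqrt_div; auto; try lra.
assert (0 < sqrt (p x)) by (apply sqrt_lt_R0; auto).
assert (0 < sqrt (r x)) by (apply sqrt_lt_R0; auto).
(* With p split into two roots, the identity is rational in the roots of p and r. *)
rewrite <- (sqrt_sqrt (p x)) at 1 by lra; field; lra.
Qed.

Lemma liouville_tau (p r : R -> R) (x : R) :
  0 < p x -> 0 < r x ->
  sqrt (r x / p x) = r x * liouville_w p r x ^ 2.
Proof.
intros hp hr; rewrite liouville_w_sqr, sqrt_div; auto; try lra.
assert (0 < sqrt (p x)) by (apply sqrt_lt_R0; auto).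
assert (0 < sqrt (r x)) by (apply sqrt_lt_R0; auto).
rewrite <- (sqrt_sqrt (r x)) at 2 by lra; field; lra.
Qed.

(** * Transport of functions, equations and boundary conditions *)

Lemma transform_iff (a b alpha beta : R) (t xt tau w u v : R -> R) :
  reparam a b alpha beta t xt tau ->
  (forall x, a <= x <= b -> w x <> 0) ->
  (forall s, alpha <= s <= beta -> v s = u (xt s) / w (xt s)) <->
  (forall x, a <= x <= b -> u x = w x * v (t x)).
Proof.
intros H hw; split; intros h.
- intros x hx; rewrite h by (apply (reparam_cc _ _ _ _ _ _ _ H); exact hx).
  rewrite (reparam_left _ _ _ _ _ _ _ H) by exact hx; field; auto.
- intros s hs; assert (hx := reparam_cc' _ _ _ _ _ _ _ H s hs).
  rewrite h by exact hx.
  rewrite (reparam_right _ _ _ _ _ _ _ H) by exact hs; field; auto.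
Qed.

(** Product and chain rules, along [t] in one direction and along [xt] in the other. Relative
    derivatives cover the endpoints together with the interior. *)
Lemma transform_ex_deriv (a b alpha beta : R) (t xt tau w u v : R -> R) :
  reparam a b alpha beta t xt tau ->
  (forall x, a <= x <= b -> w x <> 0) ->
  (forall x, a <= x <= b -> ex_deriv (cc a b) w x) ->
  (forall x, a <= x <= b -> u x = w x * v (t x)) ->
  (forall s, alpha <= s <= beta -> ex_deriv (cc alpha beta) v s) <->
  (forall x, a <= x <= b -> ex_deriv (cc a b) u x).
Proof.
intros H hw0 hw huv; split; intros h.
- intros x hx; destruct (hw x hx) as [w' hw'].
  destruct (h (t x) (reparam_cc _ _ _ _ _ _ _ H x hx)) as [l hl].
  eexists; apply has_deriv_ext with (fun y => w y * v (t y)); [exact hx | |].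
  { intros y hy; symmetry; apply huv, hy. }
  apply has_deriv_mult; [exact hw'|].
  apply has_deriv_comp with (2 := reparam_deriv _ _ _ _ _ _ _ H x hx) (3 := hl).
  apply (reparam_cc _ _ _ _ _ _ _ H).
- intros s hs; assert (hx := reparam_cc' _ _ _ _ _ _ _ H s hs).
  destruct (hw (xt s) hx) as [w' hw'], (h (xt s) hx) as [l hl].
  eexists; apply has_deriv_ext with (fun z => u (xt z) * / w (xt z));
    [exact hs | |].
  { intros z hz; symmetry.
    apply (proj2 (transform_iff a b alpha beta t xt tau w u v H hw0) huv z hz). }
  apply (has_deriv_comp (cc alpha beta) (cc a b) xt (fun x => u x * / w x)).
  + apply (reparam_cc' _ _ _ _ _ _ _ H).
  + exact (reparam_deriv' _ _ _ _ _ _ _ H s hs).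
  + apply has_deriv_mult; [exact hl|].
    apply has_deriv_inv; [apply hw0, hx | exact hw'].
Qed.

(** The x-derivative of 1/w is -w'/w^2, the factor dx/dt is 1/tau, and 1/(tau w^2) = p. *)
Lemma has_deriv_inv_w (a b alpha beta : R) (t xt tau p w : R -> R) (s : R) :
  reparam a b alpha beta t xt tau ->
  (forall x, a <= x <= b -> w x <> 0) ->
  (forall x, a <= x <= b -> ex_deriv (cc a b) w x) ->
  (forall x, a <= x <= b -> p x * tau x * w x ^ 2 = 1) ->
  cc alpha beta s ->
  has_deriv (cc alpha beta) (fun z => / w (xt z)) s
    (- (p (xt s) * Deriv (cc a b) w (xt s))).
Proof.
intros H hw0 hw hpt hs; assert (hx := reparam_cc' _ _ _ _ _ _ _ H s hs).
assert (ht := reparam_pos _ _ _ _ _ _ _ H _ hx).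
set (w' := Deriv (cc a b) w (xt s)).
replace (- (p (xt s) * w')) with (/ tau (xt s) * (- w' / w (xt s) ^ 2)).
- apply (has_deriv_comp (cc alpha beta) (cc a b) xt (fun x => / w x)).
  + apply (reparam_cc' _ _ _ _ _ _ _ H).
  + exact (reparam_deriv' _ _ _ _ _ _ _ H s hs).
  + apply has_deriv_inv; [apply hw0, hx|].
    apply has_deriv_Deriv, hw, hx.
- replace (p (xt s)) with (/ (tau (xt s) * w (xt s) ^ 2)).
  + field; split; [apply hw0, hx | lra].
  + assert (hne := hw0 _ hx); symmetry.
    apply Rmult_eq_reg_r with (tau (xt s) * w (xt s) ^ 2).
    * rewrite <- Rmult_assoc, hpt by exact hx; field; split; [exact hne | lra].
    * apply Rmult_integral_contrapositive; split; [lra | apply pow_nonzero; auto].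
Qed.

(** The product rule gives p u' = p w' v + (p tau w) dv/dt, where p tau w = 1/w = m and p w' =
    -dm/dt. *)
Lemma transform_flux (a b alpha beta : R) (t xt tau p w u v : R -> R) (x : R) :
  let m := fun z => / w (xt z) in
  reparam a b alpha beta t xt tau ->
  (forall x, a <= x <= b -> w x <> 0) ->
  (forall x, a <= x <= b -> ex_deriv (cc a b) w x) ->
  (forall x, a <= x <= b -> p x * tau x * w x ^ 2 = 1) ->
  (forall x, a <= x <= b -> u x = w x * v (t x)) ->
  cc a b x -> ex_deriv (cc alpha beta) v (t x) ->
  p x * Deriv (cc a b) u x =
    m (t x) * Deriv (cc alpha beta) v (t x)
    - v (t x) * Deriv (cc alpha beta) m (t x).
Proof.
intros m H hw0 hw hpt huv hx hv.
assert (hs := reparam_cc _ _ _ _ _ _ _ H x hx).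
assert (hxx := reparam_left _ _ _ _ _ _ _ H x hx).
rewrite (Deriv_eq alpha beta m (t x) _ (reparam_lt' _ _ _ _ _ _ _ H) hs
  (has_deriv_inv_w a b alpha beta t xt tau p w (t x) H hw0 hw hpt hs)).
unfold m; rewrite hxx.
set (w' := Deriv (cc a b) w x); set (v' := Deriv (cc alpha beta) v (t x)).
rewrite (Deriv_eq a b u x (w' * v (t x) + w x * (tau x * v'))).
- replace (/ w x) with (p x * tau x * w x); [ring|].
  apply Rmult_eq_reg_r with (w x); [|apply hw0, hx].
  rewrite Rinv_l by apply hw0, hx; rewrite <- (hpt x hx); ring.
- apply (reparam_lt _ _ _ _ _ _ _ H).
- exact hx.
- apply has_deriv_ext with (fun y => w y * v (t y)); [exact hx | |].
  { intros y hy; symmetry; apply huv, hy. }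
  apply (has_deriv_mult (cc a b) w (fun y => v (t y)));
    [apply has_deriv_Deriv, hw, hx|].
  apply (has_deriv_comp (cc a b) (cc alpha beta)).
  + apply (reparam_cc _ _ _ _ _ _ _ H).
  + exact (reparam_deriv _ _ _ _ _ _ _ H x hx).
  + apply has_deriv_Deriv, hv.
Qed.

(** Besides the equations, the equivalence matches the existence of the second derivatives: the flux
    formula is differentiated in one direction and solved for dv/dt in the other. *)
Lemma transform_ode (a b alpha beta lam : R) (t xt tau p q r w u v : R -> R)
    (x : R) :
  let D := cc alpha beta in
  let m := fun z => / w (xt z) in
  let pdu := fun x => p x * Deriv (cc a b) u x in
  reparam a b alpha beta t xt tau ->
  (forall x, a <= x <= b -> w x <> 0) ->
  (forall x, a <= x <= b -> ex_deriv (cc a b) w x) ->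
  (forall x, a <= x <= b -> p x * tau x * w x ^ 2 = 1) ->
  (forall x, a <= x <= b -> tau x = r x * w x ^ 2) ->
  (forall x, a <= x <= b -> u x = w x * v (t x)) ->
  (forall s, alpha <= s <= beta -> ex_deriv D v s) ->
  cc a b x -> ex_deriv D (Deriv D m) (t x) ->
  (ex_deriv D (Deriv D v) (t x) /\
   - Deriv D (Deriv D v) (t x)
     + (q x / r x + w x * Deriv D (Deriv D m) (t x)) * v (t x)
   = lam * v (t x)) <->
  (ex_deriv (cc a b) pdu x /\
   - Deriv (cc a b) pdu x + q x * u x = lam * r x * u x).
Proof.
intros D m pdu H hw0 hw hpt hrt huv hv hx hm.
assert (hs : D (t x)) by exact (reparam_cc _ _ _ _ _ _ _ H x hx).
assert (hxx := reparam_left _ _ _ _ _ _ _ H x hx).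
assert (hvx := has_deriv_Deriv _ _ _ (hv _ hs)).
assert (hmx : has_deriv D m (t x) (Deriv D m (t x))).
{ apply has_deriv_Deriv; eexists.
  exact (has_deriv_inv_w a b alpha beta t xt tau p w (t x) H hw0 hw hpt hs). }
assert (hmmx := has_deriv_Deriv _ _ _ hm).
assert (hflux : forall y, cc a b y ->
  pdu y = m (t y) * Deriv D v (t y) - v (t y) * Deriv D m (t y)).
{ intros y hy; apply (transform_flux a b alpha beta t xt tau p w); auto.
  apply hv, (reparam_cc _ _ _ _ _ _ _ H y hy). }
assert (hpdu : forall A, has_deriv D (Deriv D v) (t x) A ->
  has_deriv (cc a b) pdu x
    (tau x * (/ w x * A - v (t x) * Deriv D (Deriv D m) (t x)))).
{ intros A hA.
  apply has_deriv_ext with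
    (fun y => m (t y) * Deriv D v (t y) - v (t y) * Deriv D m (t y)).
  - exact hx.
  - intros y hy; symmetry; auto.
  - assert (hG := has_deriv_minus _ _ _ _ _ _
      (has_deriv_mult _ _ _ _ _ _ hmx hA) (has_deriv_mult _ _ _ _ _ _ hvx hmmx)).
    assert (hc := has_deriv_comp (cc a b) D t _ x _ _
      (reparam_cc _ _ _ _ _ _ _ H) (reparam_deriv _ _ _ _ _ _ _ H x hx) hG).
    (* The two product rules contribute the same term (dm/dt)(dv/dt) with opposite signs; the final
       [ring] removes it. *)
    assert (hmt : m (t x) = / w x) by (unfold m; rewrite hxx; reflexivity).
    rewrite hmt in hc; eapply eq_rect; [exact hc | ring]. }
(* Solving the flux formula gives dv/dt = w (p du/dx + v dm/dt), a combination of functions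
   differentiable at the point. *)
assert (hback : ex_deriv (cc a b) pdu x -> ex_deriv D (Deriv D v) (t x)).
{ intros [k hk]; eexists.
  apply has_deriv_ext with
    (fun s => w (xt s) * (pdu (xt s) + v s * Deriv D m s)); [exact hs | |].
  - intros s hs'; assert (hxs := reparam_cc' _ _ _ _ _ _ _ H s hs').
    rewrite hflux by exact hxs.
    rewrite (reparam_right _ _ _ _ _ _ _ H) by exact hs'.
    unfold m; field; apply hw0, hxs.
  - assert (hxt := reparam_deriv' _ _ _ _ _ _ _ H (t x) hs).
    rewrite <- hxx in hk.
    apply has_deriv_mult; [|apply has_deriv_plus].
    + apply has_deriv_comp with (2 := hxt) (E := cc a b).
      * apply (reparam_cc' _ _ _ _ _ _ _ H).
      * apply has_deriv_Deriv; rewrite hxx; apply hw, hx.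
    + apply has_deriv_comp with (2 := hxt) (E := cc a b) (3 := hk).
      apply (reparam_cc' _ _ _ _ _ _ _ H).
    + apply has_deriv_mult; [exact hvx | exact hmmx]. }
assert (hwx := hw0 x hx).
assert (htau := reparam_pos _ _ _ _ _ _ _ H x hx).
assert (hrx : r x <> 0).
{ intros e; rewrite (hrt x hx), e in htau; lra. }
(* The canonical residual is r w times the Schrödinger residual, by tau = r w^2. Since r w is
   nonzero, both vanish together. *)
assert (heq : ex_deriv D (Deriv D v) (t x) ->
  - Deriv (cc a b) pdu x + q x * u x - lam * r x * u x =
  (r x * w x) * (- Deriv D (Deriv D v) (t x)
     + (q x / r x + w x * Deriv D (Deriv D m) (t x)) * v (t x)
     - lam * v (t x))).
{ intros hA.
  rewrite (Deriv_eq a b pdu x _ (reparam_lt _ _ _ _ _ _ _ H) hx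
    (hpdu _ (has_deriv_Deriv _ _ _ hA))).
  rewrite huv, hrt by exact hx; field; auto. }
split.
- intros [hA e]; split.
  + eexists; apply hpdu, has_deriv_Deriv, hA.
  + apply Rminus_diag_uniq; rewrite heq, e by exact hA; ring.
- intros [hA e]; assert (hB := hback hA); split; [exact hB|].
  assert (h := heq hB); rewrite e, Rminus_diag in h.
  apply Rminus_diag_uniq; symmetry in h.
  apply Rmult_integral in h; destruct h as [h | h]; auto.
  apply Rmult_integral in h; tauto.
Qed.

(** Multiplying c0 u - c1 p u' by w and inserting the flux formula gives (c0 w^2 - c1 p w w') v - c1
    dv/dt. The constants [c0], [c1] are generic so that both endpoints are covered. *)
Lemma transform_bc (a b alpha beta c0 c1 : R) (t xt tau p w u v : R -> R)
    (x : R) :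
  let D := cc alpha beta in
  reparam a b alpha beta t xt tau ->
  (forall x, a <= x <= b -> w x <> 0) ->
  (forall x, a <= x <= b -> ex_deriv (cc a b) w x) ->
  (forall x, a <= x <= b -> p x * tau x * w x ^ 2 = 1) ->
  (forall x, a <= x <= b -> u x = w x * v (t x)) ->
  cc a b x -> ex_deriv D v (t x) ->
  (c0 * w x ^ 2 - c1 * p x * w x * Deriv (cc a b) w x) * v (t x)
    - c1 * (p x * w x ^ 2 / Deriv D xt (t x)) * Deriv D v (t x) = 0 <->
  c0 * u x - c1 * p x * Deriv (cc a b) u x = 0.
Proof.
intros D H hw0 hw hpt huv hx hv.
assert (hs := reparam_cc _ _ _ _ _ _ _ H x hx).
assert (hxx := reparam_left _ _ _ _ _ _ _ H x hx).
assert (hwx := hw0 x hx).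
assert (htau := reparam_pos _ _ _ _ _ _ _ H x hx).
rewrite (Rmult_assoc c1 (p x) (Deriv (cc a b) u x)).
rewrite (transform_flux a b alpha beta t xt tau p w u v x); auto.
rewrite (Deriv_eq alpha beta (fun z => / w (xt z)) (t x) _
  (reparam_lt' _ _ _ _ _ _ _ H) hs
  (has_deriv_inv_w a b alpha beta t xt tau p w (t x) H hw0 hw hpt hs)).
unfold D; rewrite (Deriv_eq alpha beta xt (t x) _ (reparam_lt' _ _ _ _ _ _ _ H) hs
  (reparam_deriv' _ _ _ _ _ _ _ H (t x) hs)).
rewrite hxx, huv by exact hx.
(* This is P = 1: dx/dt equals 1/tau, so P = p tau w^2. *)
replace (p x * w x ^ 2 / / tau x) with 1
  by (rewrite <- (hpt x hx); field; lra).
set (v' := Deriv (cc alpha beta) v (t x)).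
set (E := c0 * (w x * v (t x)) - _).
match goal with |- ?L = 0 <-> _ => replace L with (w x * E) end.
- split; intros e; [|rewrite e; ring].
  apply Rmult_integral in e; tauto.
- unfold E; field; auto.
Qed.

(** * Equivalence of the Schrödinger and canonical problems *)

Theorem corollary1 (p q r : R -> R) (a b alpha : R)
    (delta0 delta1 gamma0 gamma1 : R)
    (hab : a < b)
    (hp : forall x, a <= x <= b -> 0 < p x)
    (hr : forall x, a <= x <= b -> 0 < r x)
    (hpc : forall x, a <= x <= b -> continue_in p (cc a b) x)
    (hrc : forall x, a <= x <= b -> continue_in r (cc a b) x)
    (hw : forall x, a <= x <= b -> ex_deriv (cc a b) (liouville_w p r) x)
    (hw2 : forall s, alpha < s < liouville_t p r a alpha b ->
       ex_deriv (cc alpha (liouville_t p r a alpha b))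
         (liouville_dinvw p r a b alpha) s)
    (hdelta : ~ (delta0 = 0 /\ delta1 = 0))
    (hgamma : ~ (gamma0 = 0 /\ gamma1 = 0)) :
  let w := liouville_w p r in
  let t := liouville_t p r a alpha in
  let beta := t b in
  let xt := liouville_x p r a b alpha in
  let delta2 := liouville_bc p r a b delta0 delta1 a in
  let gamma2 := liouville_bc p r a b gamma0 gamma1 b in
  let schrodinger := schrodinger_problem
    (liouville_I p q r a b alpha) (liouville_P p r a b alpha)
    alpha beta delta2 delta1 gamma2 gamma1 in
  let canonical := canonical_problem p q r a b delta0 delta1 gamma0 gamma1 in
  (t a = alpha /\
   (forall x, a < x < b -> alpha < t x < beta) /\
   (forall x, a <= x <= b -> xt (t x) = x) /\
   (forall s, alpha <= s <= beta -> a <= xt s <= b /\ t (xt s) = s)) /\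
  (forall u v : R -> R,
     (forall s, alpha <= s <= beta -> v s = u (xt s) / w (xt s)) <->
     (forall x, a <= x <= b -> u x = w x * v (t x))) /\
  (forall (lam : R) (u v : R -> R),
     (forall s, alpha <= s <= beta -> v s = u (xt s) / w (xt s)) ->
     (schrodinger lam v <-> canonical lam u)) /\
  (forall lam : R,
     eigenvalue_on alpha beta schrodinger lam <->
     eigenvalue_on a b canonical lam).
Proof.
intros w t beta xt delta2 gamma2 schrodinger canonical.
assert (H : reparam a b alpha beta t xt (fun x => sqrt (r x / p x)))
  by exact (liouville_reparam p r a b alpha hab hp hr hpc hrc).
assert (hw0 : forall x, a <= x <= b -> w x <> 0)
  by (intros x _; apply Rgt_not_eq, liouville_w_pos).
assert (hpt : forall x, a <= x <= b ->
  p x * sqrt (r x / p x) * w x ^ 2 = 1)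
  by (intros; apply liouville_p_tau; auto).
assert (hrt : forall x, a <= x <= b -> sqrt (r x / p x) = r x * w x ^ 2)
  by (intros; apply liouville_tau; auto).
assert (htrans := fun u v => transform_iff a b alpha beta t xt _ w u v H hw0).
assert (hcaa : cc a b a) by (unfold cc; lra).
assert (hcbb : cc a b b) by (unfold cc; lra).
assert (hta := reparam_a _ _ _ _ _ _ _ H).
assert (hxa : xt alpha = a).
{ rewrite <- hta; apply (reparam_left _ _ _ _ _ _ _ H), hcaa. }
assert (hxb : xt beta = b) by apply (reparam_left _ _ _ _ _ _ _ H), hcbb.
assert (hequiv : forall (lam : R) (u v : R -> R),
  (forall x, a <= x <= b -> u x = w x * v (t x)) ->
  (schrodinger lam v <-> canonical lam u)).
{ intros lam u v huv.
  assert (hder := transform_ex_deriv a b alpha beta t xt _ w u v H hw0 hw huv).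
  assert (hode := fun hv x => transform_ode a b alpha beta lam t xt _ p q r w u v x
    H hw0 hw hpt hrt huv hv).
  assert (hbc := fun c0 c1 x => transform_bc a b alpha beta c0 c1 t xt _ p w u v x
    H hw0 hw hpt huv).
  unfold schrodinger, canonical, schrodinger_problem, canonical_problem.
  rewrite <- hder.
  (* First-order differentiability already matches by [hder]. Assuming it, the equation and the two
     boundary conditions can be compared one at a time. *)
  cut ((forall s, alpha <= s <= beta -> ex_deriv (cc alpha beta) v s) ->
    ((forall s, alpha < s < beta ->
       ex_deriv (cc alpha beta) (Deriv (cc alpha beta) v) s /\
       - Deriv (cc alpha beta) (Deriv (cc alpha beta) v) s
         + liouville_I p q r a b alpha s * v s = lam * v s) <->
     (forall x, a < x < b ->
       ex_deriv (cc a b) (fun x => p x * Deriv (cc a b) u x) x /\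
       - Deriv (cc a b) (fun x => p x * Deriv (cc a b) u x) x + q x * u x
       = lam * r x * u x)) /\
    (delta2 * v alpha - delta1 * liouville_P p r a b alpha alpha
       * Deriv (cc alpha beta) v alpha = 0 <->
     delta0 * u a - delta1 * p a * Deriv (cc a b) u a = 0) /\
    (gamma2 * v beta - gamma1 * liouville_P p r a b alpha beta
       * Deriv (cc alpha beta) v beta = 0 <->
     gamma0 * u b - gamma1 * p b * Deriv (cc a b) u b = 0)).
  { intros h; split; intros (h1 & h2 & h3 & h4);
      destruct (h h1) as (e2 & e3 & e4); repeat split; auto; try tauto;
      apply e2; auto. }
  intros hv; split; [split; intros h|split].
  - intros x hx.
    assert (hs := reparam_oo _ _ _ _ _ _ _ H x hx).
    assert (hx' : cc a b x) by (unfold cc; lra).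
    apply (hode hv x hx'); [apply hw2, hs|].
    (* Only the arguments of q, r and w become [xt (t x)], which turns the potential into
       [liouville_I] at [t x]. *)
    rewrite <- (reparam_left _ _ _ _ _ _ _ H x hx') at 3 4 5.
    apply h, hs.
  - intros s hs.
    assert (hx := reparam_oo' _ _ _ _ _ _ _ H s hs).
    assert (hx' : cc a b (xt s)) by (unfold cc; lra).
    assert (hss : t (xt s) = s)
      by (apply (reparam_right _ _ _ _ _ _ _ H); unfold cc; lra).
    assert (ho := hode hv (xt s) hx'); rewrite hss in ho.
    apply ho; [apply hw2, hs | apply h, hx].
  - assert (hb := hbc delta0 delta1 a hcaa); rewrite hta in hb.
    unfold liouville_P; fold xt; rewrite hxa.
    apply hb, hv; assert (hl := reparam_lt' _ _ _ _ _ _ _ H); lra.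
  - assert (hb := hbc gamma0 gamma1 b hcbb); fold beta in hb.
    unfold liouville_P; fold xt; rewrite hxb.
    apply hb, hv; assert (hl := reparam_lt' _ _ _ _ _ _ _ H); lra. }
split; [repeat split|split; [exact htrans|split; [|split]]].
- exact hta.
- apply (reparam_oo _ _ _ _ _ _ _ H); auto.
- apply (reparam_oo _ _ _ _ _ _ _ H); auto.
- apply (reparam_left _ _ _ _ _ _ _ H).
- apply (reparam_cc' _ _ _ _ _ _ _ H); auto.
- apply (reparam_cc' _ _ _ _ _ _ _ H); auto.
- apply (reparam_right _ _ _ _ _ _ _ H); auto.
- intros lam u v huv; exact (hequiv lam u v (proj1 (htrans u v) huv)).
- intros [v [hv [s [hs hne]]]].
  (* The eigenfunction stays nontrivial: w has no zeros, so [u] is nonzero at [xt s] wherever [v s]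
     is nonzero. *)
  exists (fun x => w x * v (t x)); split.
  + apply (hequiv lam _ v); auto.
  + exists (xt s); split; [apply (reparam_cc' _ _ _ _ _ _ _ H), hs|].
    rewrite (reparam_right _ _ _ _ _ _ _ H) by exact hs.
    apply Rmult_integral_contrapositive; split; auto.
    apply hw0, (reparam_cc' _ _ _ _ _ _ _ H), hs.
- intros [u [hu [x [hx hne]]]].
  (* Here [v] is defined as u/w, so the first form of the transformation holds by reflexivity and is
     converted to u = w v. *)
  assert (huv := proj1 (htrans u (fun s => u (xt s) / w (xt s))) (fun s _ => eq_refl)).
  exists (fun s => u (xt s) / w (xt s)); split.
  + apply (hequiv lam u); auto.
  + exists (t x); split; [apply (reparam_cc _ _ _ _ _ _ _ H), hx|].
    intros e; apply hne; rewrite huv by exact hx; rewrite e; ring.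
Qed.
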